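(* Let $G_i^{\alpha_i}$ be presentations of non-trivial groups $G_i$, for $i=1,2$, with disjoint finite generating sets of cardinalities $n_i$ respectively, and let $G^{\alpha}$ be the induced presentation of $G=G_1\times G_2$. Then $$\hat\Xi(G^{\alpha})=\hat\Xi(G_1^{\alpha_1})+\hat\Xi(G_2^{\alpha_2})-\left(\frac{1}{|G_1|}+\frac{1}{|G_2|}-\frac{1}{|G|}\right).$$
   Context: Conventions: $1/|K|$ is defined to be $0$ if the group $K$ is infinite. If $G_i^{\alpha_i}=\langle X_i\mid R_i\rangle$, $i=1,2$, with $X_1\cap X_2=\emptyset$, the induced presentation of $G_1\times G_2$ has generating set $X_1\cup X_2$ and relators $R_1\cup R_2$ together with the commutators of elements of $X_1$ with elements of $X_2$. For a presentation $K^{\kappa}=\langle X\mid R\rangle$ of a group $K$, $X=\{x_1,\dots,x_n\}$ finite (generators are regarded as distinct symbols, although different symbols may represent the same element of $K$ and a symbol may represent the identity), the associated Cayley graph $\Gamma$ has vertex set $K$ and, for every $g\in K$ and every $j$, exactly one edge from $g$ to $gx_j$, labelled $x_j$ (loops and multiple edges are allowed). For a non-empty finite subgraph $\Gamma'$ of $\Gamma$ let $\beta_0(\Gamma')$ be its number of vertices, let $\beta_2(\Gamma')$ be its cyclomatic number, i.e. the sum over its connected components of the rank of the fundamental group of the component, and let $\xi(\Gamma')=\beta_2(\Gamma')/\beta_0(\Gamma')$. An exhausting chain is a sequence $\Gamma_1\subseteq\Gamma_2\subseteq\cdots$ of finite connected subgraphs of $\Gamma$ whose union is $\Gamma$. The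 cyclomatic quotient is $$\Xi(K^{\kappa})=\sup\limsup_{i\to\infty}\xi(\Gamma_i),$$ the supremum being over all exhausting chains; equivalently, $\Xi(K^{\kappa})=\sup\xi(\Gamma')$ over all non-empty finite subgraphs $\Gamma'$ of $\Gamma$. The normalized cyclomatic quotient is $\hat\Xi(K^{\kappa})=1-n+\Xi(K^{\kappa})$. *)

(* Defs.v *)
From mathcomp Require Import all_boot all_order all_algebra.
From mathcomp Require Import finmap.
From mathcomp Require Import all_classical all_reals all_analysis.

Set Implicit Arguments.
Unset Strict Implicit.
Unset Printing Implicit Defensive.

Local Open Scope classical_set_scope.
Local Open Scope fset_scope.
Local Open Scope group_scope.

(* A letter (x, false) stands for the symbol x and (x, true) for its formal
   inverse. *)
Definition word (X : Type) := seq (X * bool).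

Definition inv_letter (X : Type) (l : X * bool) : X * bool := (l.1, ~~ l.2).

Definition inv_word (X : Type) (w : word X) : word X :=
  rev (map (@inv_letter X) w).

Definition map_word (X Y : Type) (f : X -> Y) (w : word X) : word Y :=
  [seq (f l.1, l.2) | l <- w].

(* word_equiv S u v holds iff u and v represent the same element of the group
   < X | S >: one is obtained from the other by finitely many insertions and
   deletions of relators and of trivial words x x^-1, x^-1 x. *)
Inductive word_equiv (X : Type) (S : set (word X)) : word X -> word X -> Prop :=
| WordRefl u : word_equiv S u u
| WordSym u v : word_equiv S u v -> word_equiv S v u
| WordTrans u v w : word_equiv S u v -> word_equiv S v w -> word_equiv S u w
| WordRelator p r q : S r -> word_equiv S (p ++ q) (p ++ r ++ q)
| WordCancel p l q : word_equiv S (p ++ q) (p ++ [:: l; inv_letter l] ++ q).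

Definition eval_letter (X : Type) (K : groupType) (f : X -> K)
  (l : X * bool) : K := if l.2 then (f l.1)^-1 else f l.1.

Definition eval_word (X : Type) (K : groupType) (f : X -> K) (w : word X) : K :=
  \prod_(l <- w) eval_letter f l.

(* A finite generating set of symbols (the value map need not be injective, nor
   avoid the identity) and an arbitrary, possibly infinite, set of relators. *)
Record presentation (K : groupType) := Presentation {
  pgen : finType;
  pval : pgen -> K;
  prel : set (word pgen);
  pval_generates : forall g : K, exists w : word pgen, eval_word pval w = g;
  prel_presents : forall w : word pgen,
    eval_word pval w = 1 <-> word_equiv prel w [::] }.

Arguments pgen {K} P : rename.
Arguments pval {K} P _ : rename.
Arguments prel {K} P _ : rename.

Lemma eval_word_cat (Y : Type) (K : groupType) (f : Y -> K) u v :
  eval_word f (u ++ v) = eval_word f u * eval_word f v.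
Proof. by rewrite /eval_word big_cat. Qed.

Lemma eval_word_cons (Y : Type) (K : groupType) (f : Y -> K) l v :
  eval_word f (l :: v) = eval_letter f l * eval_word f v.
Proof. by rewrite /eval_word big_cons. Qed.

Lemma eval_word_nil (Y : Type) (K : groupType) (f : Y -> K) :
  eval_word f [::] = 1.
Proof. by rewrite /eval_word big_nil. Qed.

Lemma word_equiv_catl (Y : Type) (S : set (word Y)) p u v :
  word_equiv S u v -> word_equiv S (p ++ u) (p ++ v).
Proof.
elim=> [a|a b _|a b c _ ab _|a r q Sr|a l q].
- exact: WordRefl.
- exact: WordSym.
- exact: WordTrans.
- by rewrite !catA -(catA (p ++ a) r); apply: WordRelator.
- by rewrite !(catA p); apply: WordCancel.
Qed.

Lemma word_equiv_catr (Y : Type) (S : set (word Y)) p u v :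
  word_equiv S u v -> word_equiv S (u ++ p) (v ++ p).
Proof.
elim=> [a|a b _|a b c _ ab _|a r q Sr|a l q].
- exact: WordRefl.
- exact: WordSym.
- exact: WordTrans.
- by rewrite -!catA; apply: WordRelator.
- by rewrite -!catA; apply: WordCancel.
Qed.

Lemma word_equiv_map (Y Z : Type) (f : Y -> Z) S (T : set (word Z)) u v :
  (forall r, S r -> T (map_word f r)) ->
  word_equiv S u v -> word_equiv T (map_word f u) (map_word f v).
Proof.
move=> ST; elim=> [a|a b _|a b c _ ab _|a r q Sr|a l q].
- exact: WordRefl.
- exact: WordSym.
- exact: WordTrans.
- by rewrite /map_word !map_cat; apply/WordRelator/ST.
- by rewrite /map_word !map_cat /=; apply: (WordCancel T _ (f l.1, l.2)).
Qed.

Lemma word_equiv_eval (Y : Type) (K : groupType) (f : Y -> K) S u v :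
  (forall r, S r -> eval_word f r = 1) ->
  word_equiv S u v -> eval_word f u = eval_word f v.
Proof.
move=> S1; elim=> [a|a b _|a b c _ ab _|a r q Sr|a [x b] q] //.
- by rewrite ab => ->.
- by rewrite !eval_word_cat (S1 _ Sr) mul1g.
- rewrite !eval_word_cat !eval_word_cons eval_word_nil mulg1 /eval_letter /=.
  by case: b; rewrite /= ?mulgV ?mulVg mul1g.
Qed.

Section ProductPresentation.

Variables (G1 G2 : groupType) (P1 : presentation G1) (P2 : presentation G2).

(* The disjoint union of the two generating sets. *)
Local Notation X := (pgen P1 + pgen P2)%type.
Local Notation in1 := (@map_word (pgen P1) X inl).
Local Notation in2 := (@map_word (pgen P2) X inr).

Definition prod_pval (x : X) : (G1 * G2)%type :=
  match x with inl a => (pval P1 a, 1) | inr b => (1, pval P2 b) end.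

Definition commutator_word (x y : X) : word X :=
  [:: (x, false); (y, false); (x, true); (y, true)].

Definition prod_prel : set (word X) :=
  [set w | [\/ exists2 r, prel P1 r & w = in1 r,
               exists2 r, prel P2 r & w = in2 r |
               exists a b, w = commutator_word (inl a) (inr b)]].

Lemma pair_mulg (a c : G1) (b d : G2) : (a, b) * (c, d) = (a * c, b * d).
Proof. by []. Qed.

Lemma eval_word_inl w : eval_word prod_pval (in1 w) = (eval_word (pval P1) w, 1).
Proof.
elim: w => [|[x b] w IH]; first by rewrite !eval_word_nil.
rewrite /in1 /= !eval_word_cons IH /eval_letter /=.
by case: b; rewrite ?pair_mulg /= -?[(_, _)^-1]/(_^-1, _^-1) ?pair_mulg ?invg1 ?mul1g.
Qed.

Lemma eval_word_inr w : eval_word prod_pval (in2 w) = (1, eval_word (pval P2) w).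
Proof.
elim: w => [|[x b] w IH]; first by rewrite !eval_word_nil.
rewrite /in2 /= !eval_word_cons IH /eval_letter /=.
by case: b; rewrite ?pair_mulg /= -?[(_, _)^-1]/(_^-1, _^-1) ?pair_mulg ?invg1 ?mul1g.
Qed.

Lemma prod_pval_generates (g : (G1 * G2)%type) :
  exists w, eval_word prod_pval w = g.
Proof.
case: g => g1 g2.
have [w1 <-] := pval_generates P1 g1; have [w2 <-] := pval_generates P2 g2.
by exists (in1 w1 ++ in2 w2); rewrite eval_word_cat eval_word_inl eval_word_inr pair_mulg mulg1 mul1g.
Qed.

Notation "u ~~> v" := (word_equiv prod_prel u v) (at level 70).

Lemma prod_equiv_inv (l m : X * bool) :
  [:: l; m] ~~> [:: m; l] -> [:: inv_letter l; m] ~~> [:: m; inv_letter l].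
Proof.
move=> lm; set k := inv_letter l.
have kK : inv_letter k = l by rewrite /k /inv_letter /= negbK; case: (l).
apply: WordTrans (WordCancel prod_prel [:: k; m] l [::]) _.
rewrite /= -/k; apply: (@WordTrans _ _ _ [:: k; l; m; k]).
  exact: (word_equiv_catl [:: k] (word_equiv_catr [:: k] (WordSym lm))).
by apply: WordSym; have := WordCancel prod_prel [::] k [:: m; k]; rewrite kK.
Qed.

Lemma prod_equiv_commute (a : pgen P1) (b : pgen P2) (s t : bool) :
  [:: (inr b, t); (inl a, s)] ~~> [:: (inl a, s); (inr b, t)].
Proof.
have H : [:: (inr b, false); (inl a, false)] ~~>
         [:: (inl a, false); (inr b, false)].
  have C : prod_prel (commutator_word (inl a) (inr b)) by apply: Or33; exists a, b.
  apply: WordTrans (WordRelator [::] [:: (inr b, false); (inl a, false)] C) _.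
  rewrite /=; apply: WordSym.
  apply: WordTrans (WordCancel _ [:: (inl a, false); (inr b, false)]
    (inl a, true) [::]) _.
  by apply: (WordCancel _ [:: (inl a, false); (inr b, false); (inl a, true)]
    (inr b, true) [:: (inl a, false)]).
have H2 u : [:: (inr b, u); (inl a, false)] ~~> [:: (inl a, false); (inr b, u)].
  by case: u => //; have := prod_equiv_inv H.
by case: s => //; apply: WordSym; apply: (@prod_equiv_inv (inl a, false));
  apply: WordSym.
Qed.

Lemma prod_equiv_swap w (a : pgen P1) (s : bool) :
  in2 w ++ [:: (inl a, s)] ~~> (inl a, s) :: in2 w.
Proof.
elim: w => [|[b t] w IH]; first exact: WordRefl.
apply: WordTrans (word_equiv_catl [:: (inr b, t)] IH) _.
exact: (word_equiv_catr (in2 w) (prod_equiv_commute a b s t)).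
Qed.

Lemma prod_equiv_split w : exists w1 w2, w ~~> in1 w1 ++ in2 w2.
Proof.
elim/last_ind: w => [|w [[a|b] s] [w1 [w2 IH]]].
- by exists [::], [::]; apply: WordRefl.
- exists (w1 ++ [:: (a, s)]), w2; rewrite -cats1.
  apply: WordTrans (word_equiv_catr _ IH) _.
  by rewrite -catA /in1 /map_word map_cat -catA; apply/word_equiv_catl/prod_equiv_swap.
- exists w1, (w2 ++ [:: (b, s)]); rewrite -cats1.
  apply: WordTrans (word_equiv_catr _ IH) _.
  by rewrite -catA /in2 /map_word map_cat; apply: WordRefl.
Qed.

Lemma prod_prel_eval r : prod_prel r -> eval_word prod_pval r = 1.
Proof.
case=> [[q Sq ->]|[q Sq ->]|[a [b ->]]].
- rewrite eval_word_inl (_ : eval_word _ q = 1) //; apply/prel_presents.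
  by apply: WordSym; have := WordRelator [::] [::] Sq; rewrite /= (cats0 q).
- rewrite eval_word_inr (_ : eval_word _ q = 1) //; apply/prel_presents.
  by apply: WordSym; have := WordRelator [::] [::] Sq; rewrite /= (cats0 q).
- rewrite !eval_word_cons eval_word_nil /eval_letter mulg1 [LHS]surjective_pairing.
  by rewrite -[RHS]/(1, 1); congr (_, _); rewrite /= ?invg1 ?mulg1 ?mul1g ?mulgV.
Qed.

Lemma prod_prel_presents (w : word X) :
  eval_word prod_pval w = 1 <-> word_equiv prod_prel w [::].
Proof.
split=> [w1|/(word_equiv_eval prod_prel_eval)]; last by rewrite eval_word_nil.
have [u1 [u2 E]] := prod_equiv_split w; apply: (WordTrans E).
have : eval_word prod_pval (in1 u1 ++ in2 u2) = 1.
  by rewrite -w1 (word_equiv_eval prod_prel_eval E).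
rewrite eval_word_cat eval_word_inl eval_word_inr pair_mulg mulg1 mul1g => -[/prel_presents E1].
move=> /prel_presents E2.
apply: (@WordTrans _ _ _ (in2 u2)).
  apply: (word_equiv_catr (in2 u2) (v := [::])); apply: (word_equiv_map _ E1).
  by move=> r Sr; apply: Or31; exists r.
by apply: (word_equiv_map _ E2) => r Sr; apply: Or32; exists r.
Qed.

Definition prod_presentation : presentation (G1 * G2)%type :=
  Presentation prod_pval_generates prod_prel_presents.

End ProductPresentation.

Section CayleyGraph.

Variables (K : groupType) (P : presentation K).

(* (g, x) is the edge of the Cayley graph from g to g x, labelled x. *)
Definition cedge := (K * pgen P)%type.

Definition csource (e : cedge) : K := e.1.
Definition ctarget (e : cedge) : K := e.1 * pval P e.2.

Record subgraph := Subgraph {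
  sverts : {fset K};
  sedges : {fset cedge};
  sedges_source : forall e, e \in sedges -> csource e \in sverts;
  sedges_target : forall e, e \in sedges -> ctarget e \in sverts }.

(* An oriented edge is a pair (e, b); b = true means that e is traversed
   backwards.  A walk is the word of its oriented edges. *)
Definition origin (a : cedge * bool) : K :=
  if a.2 then ctarget a.1 else csource a.1.
Definition terminus (a : cedge * bool) : K :=
  if a.2 then csource a.1 else ctarget a.1.

Fixpoint walk (D : subgraph) (v w : K) (p : word cedge) : bool :=
  if p is a :: q then
    [&& a.1 \in sedges D, origin a == v & walk D (terminus a) w q]
  else (v \in sverts D) && (v == w).

Definition joined (D : subgraph) (v w : K) : Prop := exists p, walk D v w p.

Definition connected_subgraph (D : subgraph) : Prop :=
  sverts D != fset0 /\
  forall v w, v \in sverts D -> w \in sverts D -> joined D v w.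

Inductive homotopic (D : subgraph) (v w : K) : word cedge -> word cedge -> Prop :=
| HomotopicRefl p : homotopic D v w p p
| HomotopicSym p q : homotopic D v w p q -> homotopic D v w q p
| HomotopicTrans p q r :
    homotopic D v w p q -> homotopic D v w q r -> homotopic D v w p r
| HomotopicBacktrack p a q :
    walk D v w (p ++ q) -> walk D v w (p ++ [:: a; inv_letter a] ++ q) ->
    homotopic D v w (p ++ q) (p ++ [:: a; inv_letter a] ++ q).

Definition loop_product (k : nat) (L : 'I_k -> word cedge) (s : word 'I_k) :
  word cedge := flatten [seq if i.2 then inv_word (L i.1) else L i.1 | i <- s].

(* The fundamental group pi_1(D, v), made of the homotopy classes of closed
   walks at v, is generated by k elements. *)
Definition pi1_generated_by (D : subgraph) (v : K) (k : nat) : Prop :=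
  exists2 L : 'I_k -> word cedge, (forall i, walk D v v (L i)) &
    forall p, walk D v v p ->
      exists s : word 'I_k, homotopic D v v p (loop_product L s).

(* The rank of a group is its minimal number of generators; the default value 0
   is never used, since D is finite. *)
Definition pi1_rank (D : subgraph) (v : K) : nat :=
  xget 0%N [set k | pi1_generated_by D v k /\
                    forall j, pi1_generated_by D v j -> (k <= j)%N].

Definition component (D : subgraph) (v : K) : {fset K} :=
  [fset w in sverts D | `[< joined D v w >]].

Definition components (D : subgraph) : {fset {fset K}} :=
  [fset component D v | v in sverts D].

(* A vertex of C, for C non-empty. *)
Definition base_point (C : {fset K}) : K := xget 1 [set v | v \in C].

Definition beta0 (D : subgraph) : nat := #|` sverts D|.

Definition beta2 (D : subgraph) : nat :=
  \sum_(C <- components D) pi1_rank D (base_point C).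

Definition exhausting_chain (D : nat -> subgraph) : Prop :=
  [/\ forall i, connected_subgraph (D i),
      forall i, sverts (D i) `<=` sverts (D i.+1) /\
                sedges (D i) `<=` sedges (D i.+1),
      forall g : K, exists i, g \in sverts (D i) &
      forall e : cedge, exists i, e \in sedges (D i)].

End CayleyGraph.

Section CyclomaticQuotient.

Variables (R : realType) (K : groupType).

Local Open Scope ring_scope.

Definition xi (P : presentation K) (D : subgraph P) : R :=
  (beta2 D)%:R / (beta0 D)%:R.

Definition cyclomatic_quotient (P : presentation K) : \bar R :=
  ereal_sup [set limn_esup (fun i => (xi (D i))%:E) |
             D in [set D : nat -> subgraph P | exhausting_chain D]].

Definition normalized_cyclomatic_quotient (P : presentation K) : \bar R :=
  ((1 - #|pgen P|%:R)%:E + cyclomatic_quotient P)%E.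

Definition inv_card : R :=
  if `[< finite_set [set: K] >] then (#|` fset_set [set: K]|%:R)^-1 else 0.

End CyclomaticQuotient.

Arguments normalized_cyclomatic_quotient R {K} P.
Arguments inv_card R K : clear implicits.

(* Main.v *)
Require Import Defs.
From mathcomp Require Import all_boot all_order all_algebra.
From mathcomp Require Import finmap.
From mathcomp Require Import all_classical all_reals all_analysis.
From mathcomp Require Import lra.

(** For a finite set [F] of vertices of the Cayley graph let [i(F)] be the number
   of edges with both ends in [F], and let [alpha] be the supremum of
   [i(F) / |F|] over all finite non-empty [F].  The theorem follows from two
   facts:

   - [Xi = alpha - 1 + 1/|K|] for every presentation (cyclomatic_quotientE);
   - [alpha] is additive under direct products (edge_density_prod).

   Indeed the normalized cyclomatic quotient is then [alpha - n + 1/|K|], and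
   both [alpha] and [n] are additive.

   Additivity.  An edge of the product changes at most one coordinate, so [i(F)]
   is the sum of the [i] of all slices of [F] in the two directions, while each
   of the two families of slices partitions [F]; hence the density of [F] is at
   most [alpha1 + alpha2].  All slices of a product set [F1 x F2] are copies of
   [F1] or of [F2], so that such sets come arbitrarily close to this bound.

   The formula for [Xi].  The fundamental group of a connected graph with [V]
   vertices and [E] edges has rank [E - V + 1] (beta2_connected): the loops that
   the edges outside a spanning tree close up in it generate the group, and no
   smaller family does, because the signed numbers of passages through these
   edges are homotopy invariant and separate the loops.  So a connected subgraph
   has [xi = E/V - 1 + 1/V].  Along an exhausting chain [1/V] tends to [1/|K|]
   and [E/V <= alpha], which gives the upper bound.  The lower bound asks for
   exhausting chains of connected subgraphs of density nearly [alpha], that is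
   (conn_dense_above), for connected sets of nearly maximal density above any
   given finite connected set [U].  The defect [alpha |F| - i(F)] is
   non-negative, submodular, translation invariant, and non-positive on the
   whole group when this is finite.  Choose [M] large compared with the defect
   of [U], then a connected [F] whose defect is at most [(eps/M) |F|], and add
   successively [M] translates of [F], each through a point outside but adjacent
   to the set obtained so far.  Unless this reaches the whole group, the result
   is connected, has at least [max(M, |F|)] points, and its defect is at most
   that of [U] plus [M] times that of [F]. *)

Set Implicit Arguments.
Unset Strict Implicit.
Unset Printing Implicit Defensive.

Import Order.TTheory GRing.Theory Num.Theory.
Import numFieldNormedType.Exports.

(** * The rank of the fundamental group of a connected graph *)

Section Walks.

Local Open Scope fset_scope.

Variables (K : groupType) (P : presentation K) (D : subgraph P).

Implicit Types (u v w : K) (p q r : word (cedge P)) (a : cedge P * bool).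

Lemma inv_letterK (X : Type) : involutive (@inv_letter X).
Proof. by case=> x b; rewrite /inv_letter /= negbK. Qed.

Lemma inv_wordK (X : Type) : involutive (@inv_word X).
Proof. by move=> s; rewrite /inv_word map_rev revK mapK //; apply: inv_letterK. Qed.

Lemma inv_word_cat (X : Type) (s t : word X) :
  inv_word (s ++ t) = inv_word t ++ inv_word s.
Proof. by rewrite /inv_word map_cat rev_cat. Qed.

Lemma origin_inv a : origin (inv_letter a) = terminus a.
Proof. by case: a => e []. Qed.

Lemma terminus_inv a : terminus (inv_letter a) = origin a.
Proof. by case: a => e []. Qed.

Lemma origin_in a : a.1 \in sedges D -> origin a \in sverts D.
Proof.
case: a => e [] /=; rewrite /origin /=; [exact: sedges_target|exact: sedges_source].
Qed.

Lemma terminus_in a : a.1 \in sedges D -> terminus a \in sverts D.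
Proof. by rewrite -origin_inv => aD; apply: origin_in. Qed.

Lemma walk_letter a : a.1 \in sedges D -> walk D (origin a) (terminus a) [:: a].
Proof. by move=> aD /=; rewrite aD terminus_in // !eqxx. Qed.

Lemma walk_cat u v w p q : walk D u v p -> walk D v w q -> walk D u w (p ++ q).
Proof.
elim: p u => [|a p IH] u /=; first by case/andP=> _ /eqP ->.
by case/and3P=> -> -> /= up vq; apply: IH.
Qed.

Lemma walk_inv u v p : walk D u v p -> walk D v u (inv_word p).
Proof.
elim: p u => [|a p IH] u /=.
  by case/andP=> uD /eqP uv; rewrite -uv uD eqxx.
case/and3P=> aD /eqP <- /IH h.
rewrite -cat1s inv_word_cat; apply: walk_cat h _.
by rewrite -origin_inv -(terminus_inv a); apply: walk_letter.
Qed.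

Lemma walk_source u v p : walk D u v p -> u \in sverts D.
Proof.
by case: p => [|a p] /= => [/andP[] //|/and3P[aD /eqP <- _]]; apply: origin_in.
Qed.

Lemma walk_target u v p : walk D u v p -> v \in sverts D.
Proof. by move/walk_inv/walk_source. Qed.

(** Homotopy of walks is compatible with concatenation. *)
Lemma homotopic_cat u v w z r s p q : walk D u v r -> walk D w z s ->
  homotopic D v w p q -> homotopic D u z (r ++ p ++ s) (r ++ q ++ s).
Proof.
move=> ur ws; elim=> [p0|p0 q0 _|p0 q0 r0 _ h1 _ h2|p0 a q0 h1 h2].
- exact: HomotopicRefl.
- exact: HomotopicSym.
- exact: HomotopicTrans h1 h2.
- have {}h1 := walk_cat ur (walk_cat h1 ws).
  have {}h2 := walk_cat ur (walk_cat h2 ws).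
  move: h1 h2; rewrite -!catA !(catA r p0); exact: HomotopicBacktrack.
Qed.

(** A walk traversed backwards and then forwards again can be deleted. *)
Lemma homotopic_cancel u x v w p q r :
  walk D u x p -> walk D v x q -> walk D x w r ->
  homotopic D u w (p ++ inv_word q ++ q ++ r) (p ++ r).
Proof.
elim: q v w r => [|a q IH] v w r up; first by move=> *; apply: HomotopicRefl.
move=> /= /and3P[aD /eqP av qx] xr.
have xinvq := walk_inv qx.
have e : p ++ inv_word (a :: q) ++ (a :: q) ++ r =
   (p ++ inv_word q) ++ [:: inv_letter a; inv_letter (inv_letter a)] ++ (q ++ r).
  by rewrite inv_letterK -(cat1s a q) inv_word_cat -!catA.
rewrite /= in e; rewrite /= e; apply: HomotopicTrans (IH _ _ r up qx xr).
rewrite catA; apply/HomotopicSym/HomotopicBacktrack.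
  exact: walk_cat (walk_cat up xinvq) (walk_cat qx xr).
apply: walk_cat (walk_cat up xinvq) _ => /=.

by rewrite aD inv_letterK origin_inv terminus_inv !eqxx; apply: walk_cat qx xr.
Qed.

(** The loop at the root that runs along the edge [a], when [t u] is a chosen
   walk from the root to [u]. *)
Definition edge_loop (t : K -> word (cedge P)) a :=
  t (origin a) ++ a :: inv_word (t (terminus a)).

Lemma edge_loop_inv t a : edge_loop t (inv_letter a) = inv_word (edge_loop t a).
Proof.
rewrite /edge_loop origin_inv terminus_inv -(cat1s a) !inv_word_cat inv_wordK.
by rewrite -catA.
Qed.

Section Root.

Variables (v0 : K) (t : K -> word (cedge P)).
Hypothesis tW : forall u, u \in sverts D -> walk D v0 u (t u).

Lemma walk_edge_loop a : a.1 \in sedges D -> walk D v0 v0 (edge_loop t a).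
Proof.
move=> aD; apply: (walk_cat (tW (origin_in aD))); rewrite -cat1s.
by apply: walk_cat (walk_letter aD) _; apply/walk_inv/tW/terminus_in.
Qed.

(** A walk from [u], preceded by the chosen walk to [u], is homotopic to the
   product of the loops of its edges. *)
Lemma homotopic_edge_loops u w p : walk D u w p ->
  homotopic D v0 w (t u ++ p) (flatten [seq edge_loop t a | a <- p] ++ t w).
Proof.
elim: p u => [|a p IH] u /=.
  by case/andP=> uD /eqP <-; rewrite cats0; apply: HomotopicRefl.
case/and3P=> aD /eqP <- ap.
have ta := tW (terminus_in aD).
apply: (@HomotopicTrans _ _ _ _ _ _ (edge_loop t a ++ t (terminus a) ++ p)); last first.
  have := homotopic_cat (walk_edge_loop aD) _ (IH _ ap).
  by move=> /(_ w [::]); rewrite !cats0 -catA; apply; rewrite /= (walk_target ap) eqxx.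
have wt := walk_cat (tW (origin_in aD)) (walk_letter aD).
have := homotopic_cancel wt ta ap.
by rewrite -!catA /= => /HomotopicSym; rewrite /edge_loop.
Qed.

End Root.



(** A walk from inside [S] to outside [S] uses an edge that leaves [S]. *)
Lemma walk_leaves (S : {fset K}) v w p : walk D v w p ->
  v \in S -> w \notin S ->
  exists2 a, a.1 \in sedges D & (origin a \in S) && (terminus a \notin S).
Proof.
elim: p v => [|a p IH] v /=; first by case/andP=> _ /eqP -> ->.
case/and3P=> aD /eqP <- ap oS wS; case: (boolP (terminus a \in S)) => tS.
  exact: IH ap tS wS.
by exists a; rewrite // oS tS.
Qed.

(** [tree_in v0 S T t]: the edges of [T] form a tree with vertex set [S], and
   [t u] is the walk in this tree from the root [v0] to [u].  The last field
   says that [e], in one of its two orientations, is the last step of the chosen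
   walk to the end of that orientation. *)
Record tree_in (v0 : K) (S : {fset K}) (T : {fset cedge P})
    (t : K -> word (cedge P)) : Prop := TreeIn {
  tree_root : v0 \in S;
  tree_sub : T `<=` sedges D;
  tree_card : #|` S| = #|` T|.+1;
  tree_root_walk : t v0 = [::];
  tree_walk : forall u, u \in S -> walk D v0 u (t u);
  tree_walk_in : forall u a, u \in S -> a \in t u -> a.1 \in T;
  tree_ends : forall a, a.1 \in T -> origin a \in S;
  tree_step : forall e, e \in T ->
    exists b, t (terminus (e, b)) = rcons (t (origin (e, b))) (e, b) }.

(** An edge that leaves the vertex set of a tree can be added to the tree. *)
Lemma tree_extend v0 S T t a : tree_in v0 S T t -> a.1 \in sedges D ->
  origin a \in S -> terminus a \notin S ->
  exists S' T' t', tree_in v0 S' T' t' /\ S' = terminus a |` S.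
Proof.
move=> [r0 sub card r1 tw twi te ts] aD oS nS.
have oN : origin a != terminus a by apply: contraNneq nS => <-.
have aT : a.1 \notin T by apply: contra nS => aT; rewrite -origin_inv; apply: te.
pose t' u := if u == terminus a then rcons (t (origin a)) a else t u.
have t'S u : u \in S -> t' u = t u.
  by move=> uS; rewrite /t'; case: eqP => // e; rewrite -e uS in nS.
exists (terminus a |` S), (a.1 |` T), t'; split=> //; split.
- by rewrite !inE r0 orbT.
- by rewrite fsubUset sub fsub1set aD.
- by rewrite !cardfsU1 nS aT card.
- by rewrite t'S.
- move=> u; rewrite !inE => /orP[/eqP ->|uS]; last by rewrite t'S ?tw.
  by rewrite /t' eqxx -cats1; apply: walk_cat (tw _ oS) (walk_letter aD).
- move=> u b; rewrite !inE => /orP[/eqP ->|uS]; last first.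
    by rewrite t'S // => /twi -> //; rewrite orbT.
  rewrite /t' eqxx mem_rcons inE => /orP[/eqP ->|/twi ->]; rewrite ?eqxx ?orbT //.
- move=> b; rewrite !inE => /orP[/eqP e|/te ->]; last by rewrite orbT.
  case: a b e oS {aD nS oN aT t' t'S} => [e b] [f c] /= -> oS.
  have [->|/negPf bc] := eqVneq c b; first by rewrite oS orbT.
  have -> : (e, c) = inv_letter (e, b) by move: bc; case: (c); case: (b).
  by rewrite origin_inv eqxx.
- move=> e; rewrite !inE => /orP[/eqP ->|eT].
    by exists a.2; rewrite -surjective_pairing (t'S _ oS) /t' eqxx.
  have [b eb] := ts _ eT; exists b; rewrite !t'S ?te //.
  by rewrite -origin_inv; apply: te.
Qed.

Lemma spanning_tree v0 : connected_subgraph D -> v0 \in sverts D ->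
  exists T t, tree_in v0 (sverts D) T t.
Proof.
move=> [_ conn] v0D.
have H n : (n < #|` sverts D|)%N ->
    exists S T t, [/\ tree_in v0 S T t, S `<=` sverts D & #|` S| = n.+1].
  elim: n => [|n IH] nD.
    exists [fset v0], fset0, (fun=> [::]); split; rewrite ?cardfs1 ?fsub1set //.
    split => //; rewrite ?inE ?cardfs1 ?cardfs0 ?fsub0set //.
    by move=> u; rewrite !inE => /eqP -> /=; rewrite v0D eqxx.
  have [S [T [t [tr SD cS]]]] := IH (ltnW nD).
  have [w wD wS] : exists2 w, w \in sverts D & w \notin S.
    have : ~~ (sverts D `<=` S).
      by apply: contraL nD => /fsubset_leq_card; rewrite cS -leqNgt.
    by case/fsubsetPn => w; exists w.
  have [p vp] := conn _ _ v0D wD.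
  have [a aD /andP[oS nS]] := walk_leaves vp (tree_root tr) wS.
  have [S' [T' [t' [tr' eS']]]] := tree_extend tr aD oS nS.
  exists S', T', t'; split=> //.
    by rewrite eS' fsubUset SD fsub1set terminus_in.
  by rewrite eS' cardfsU1 nS cS.
have D0 : (#|` sverts D|.-1 < #|` sverts D|)%N.
  by rewrite prednK // cardfs_gt0; apply/fset0Pn; exists v0.
have [S [T [t [tr SD cS]]]] := H _ D0.
exists T, t; suff <- : S = sverts D by [].
by apply/eqP; rewrite eqEfcard SD cS; case: #|` _| D0.
Qed.



Lemma homotopic_mul v p p' q q' : walk D v v p' -> walk D v v q ->
  homotopic D v v p p' -> homotopic D v v q q' ->
  homotopic D v v (p ++ q) (p' ++ q').
Proof.
move=> wp' wq hp hq; have v1 : walk D v v [::] by rewrite /= (walk_source wq) eqxx.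
apply: HomotopicTrans (_ : homotopic D v v _ (p' ++ q)) _.
  exact: homotopic_cat v1 wq hp.
by have := homotopic_cat wp' v1 hq; rewrite !cats0.
Qed.

Lemma loop_product_cat k (L : 'I_k -> word (cedge P)) s s' :
  loop_product L (s ++ s') = loop_product L s ++ loop_product L s'.
Proof. by rewrite /loop_product map_cat flatten_cat. Qed.

Lemma walk_loop_product k (L : 'I_k -> word (cedge P)) s v :
  v \in sverts D -> (forall i, walk D v v (L i)) ->
  walk D v v (loop_product L s).
Proof.
move=> vD LW; elim: s => [|[i b] s IH] /=; first by rewrite vD eqxx.
apply: walk_cat IH; case: b => /=; [exact/walk_inv/LW|exact: LW].
Qed.

Section Rank.

Variables (v0 : K) (T : {fset cedge P}) (t : K -> word (cedge P)).
Hypothesis tree : tree_in v0 (sverts D) T t.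

(* The number of edges outside the spanning tree. *)
Let m := #|` sedges D `\` T|.

(* An enumeration of these edges, the chords of the tree. *)
Let chord (i : 'I_m) : cedge P := tnth (in_tuple (enum_fset (sedges D `\` T))) i.

Let chord_in i : chord i \in sedges D `\` T.
Proof. exact: mem_tnth. Qed.

Let chordP e : e \in sedges D `\` T -> exists i, e = chord i.
Proof.
move=> eN; have /tnthP[i ei] : e \in in_tuple (enum_fset (sedges D `\` T)) by [].
by exists i.
Qed.

Let chordD i : chord i \in sedges D.
Proof. by have := chord_in i; rewrite inE => /andP[]. Qed.

Let chord_inj : injective chord.
Proof. by apply/tuple_uniqP; apply: fset_uniq. Qed.

Let tW := tree_walk tree.

(** The loops of tree edges are contractible. *)
Lemma tree_edge_loop a : a.1 \in T -> homotopic D v0 v0 (edge_loop t a) [::].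
Proof.
have step c : c.1 \in T -> t (terminus c) = rcons (t (origin c)) c ->
    homotopic D v0 v0 (edge_loop t c) [::] /\
    homotopic D v0 v0 (edge_loop t (inv_letter c)) [::].
  move=> cT tc; have := tW (tree_ends tree cT) => wo.
  have cD := fsubsetP (tree_sub tree) _ cT.
  have wt := tW (terminus_in cD).
  have v1 : walk D v0 v0 [::] by rewrite /= (walk_source wt) eqxx.
  have cancel x p : walk D v0 x p -> homotopic D v0 v0 (p ++ inv_word p) [::].
    move=> wp; have := homotopic_cancel v1 (walk_inv wp) v1.
    by rewrite inv_wordK /= cats0.
  have E : edge_loop t c = t (terminus c) ++ inv_word (t (terminus c)).
    by rewrite /edge_loop {2}tc tc -cats1 -catA.
  by rewrite edge_loop_inv E inv_word_cat inv_wordK; split; apply: cancel wt.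
move=> aT; have [b tb] := tree_step tree aT.
have [h1 h2] := step (a.1, b) aT tb.
by case: a {aT tb} h1 h2 => e [] /=; case: b => h1 h2.
Qed.

Lemma pi1_generated_by_chords : pi1_generated_by D v0 m.
Proof.
pose L i := edge_loop t (chord i, false).
have LW i : walk D v0 v0 (L i).
  exact: (walk_edge_loop tW (chordD i : (chord i, false).1 \in _)).
exists L => // p pW.
have v0D : v0 \in sverts D := walk_source pW.
have letterP a : a.1 \in sedges D ->
    exists s, homotopic D v0 v0 (edge_loop t a) (loop_product L s).
  move=> aD; case: (boolP (a.1 \in T)) => aT.
    by exists [::]; apply: tree_edge_loop.
  have [i ei] : exists i, a.1 = chord i by apply: chordP; rewrite inE aT.
  exists [:: (i, a.2)]; suff -> : edge_loop t a = loop_product L [:: (i, a.2)].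
    exact: HomotopicRefl.
  case: a ei {aD aT} => e b /= ->; rewrite /loop_product /= cats0.
  by case: b => //=; rewrite /L -edge_loop_inv.
have flatP u (q : word (cedge P)) : walk D u v0 q ->
    walk D v0 v0 (flatten [seq edge_loop t a | a <- q]) /\
    exists s, homotopic D v0 v0 (flatten [seq edge_loop t a | a <- q])
                (loop_product L s).
  elim: q u => [|a q IH] u /=.
    by move=> _; rewrite v0D eqxx; split=> //; exists [::]; apply: HomotopicRefl.
  case/and3P=> aD _ /IH [wq [s hs]].
  have wa := walk_edge_loop tW aD.
  split; first exact: walk_cat wq.
  have [s' hs'] := letterP _ aD; exists (s' ++ s); rewrite loop_product_cat.
  by apply: homotopic_mul => //; apply: walk_loop_product.
have [_ [s hs]] := flatP _ _ pW; exists s.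
have := homotopic_edge_loops tW pW; rewrite (tree_root_walk tree) cats0.
by move=> h; apply: HomotopicTrans h hs.
Qed.

Local Open Scope ring_scope.

(** The number of times, counted with sign, that a walk runs along [e]. *)
Let winding (e : cedge P) p : rat :=
  \sum_(a <- p) if a.1 == e then (-1) ^+ a.2 else 0.

Let winding_cat e p q : winding e (p ++ q) = winding e p + winding e q.
Proof. by rewrite /winding big_cat. Qed.

Let winding_inv e p : winding e (inv_word p) = - winding e p.
Proof.
elim: p => [|a p IH]; first by rewrite /winding /= big_nil oppr0.
rewrite -cat1s inv_word_cat !winding_cat IH opprD addrC; congr (_ + _).
rewrite /winding !big_seq1 /=; case: eqP => _; last by rewrite oppr0.
by case: a => [? []]; rewrite /= ?opprK.
Qed.

Let winding_homotopic e v w p q : homotopic D v w p q -> winding e p = winding e q.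
Proof.
elim=> // [p0 q0 r0 _ -> _ ->|p0 a q0 _ _] //.
rewrite !winding_cat; congr (_ + _).
rewrite -[[:: a; _]]/([:: a] ++ inv_word [:: a]) winding_cat winding_inv.
by rewrite subrr add0r.
Qed.

Let winding_chord i j : winding (chord j) (edge_loop t (chord i, false)) = (i == j)%:R.
Proof.
have tree0 u : u \in sverts D -> winding (chord j) (t u) = 0.
  move=> uD; rewrite /winding big_seq big1 // => a at_u.
  have := chord_in j; rewrite inE => /andP[/negP jT _].
  by case: eqP => // aj; case: jT; rewrite -aj; apply: (tree_walk_in tree uD at_u).
have iD := chordD i.
rewrite /edge_loop -cat1s !winding_cat winding_inv !tree0;
  [|exact: (@terminus_in (_, _))|exact: (@origin_in (_, _))].
rewrite oppr0 addr0 add0r /winding big_seq1 /= expr0 (inj_eq chord_inj).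
by case: eqP.
Qed.

(** The signed numbers of passages of the loops of the chords through the
   chords form an identity matrix, which factors through the [k] generators. *)
Lemma leq_chords_generators k : pi1_generated_by D v0 k -> (m <= k)%N.
Proof.
case=> L LW Lgen.
have /choice[s sP] i := Lgen _ (walk_edge_loop tW (chordD i : (chord i, false).1 \in _)).
pose B : 'M[rat]_(k, m) := \matrix_(l, j) winding (chord j) (L l).
pose C : 'M[rat]_(m, k) :=
  \matrix_(i, l) \sum_(c <- s i) if c.1 == l then (-1) ^+ c.2 else 0.
have CB : C *m B = 1%:M.
  apply/matrixP => i j; rewrite !mxE -winding_chord (winding_homotopic _ (sP i)).
  under eq_bigr do rewrite !mxE big_distrl /=.
  rewrite exchange_big /=; elim: (s i) => [|[l b] s' IH].
    by rewrite big_nil /loop_product /winding big_nil.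
  rewrite big_cons IH -cat1s loop_product_cat winding_cat; congr (_ + _).
    rewrite (bigD1 l) //= eqxx big1 ?addr0 => [|l' l'l]; last first.
    by rewrite eq_sym (negPf l'l) mul0r.
  by rewrite /loop_product /= cats0; case: b; rewrite ?winding_inv ?mulN1r ?mul1r.
have := mxrankM_maxl C B; rewrite CB mxrank1 => /leq_trans; apply.
exact: rank_leq_col.
Qed.

End Rank.

(** The rank of the fundamental group of a connected graph is the number of its
   edges outside a spanning tree. *)
Lemma pi1_rank_connected v : connected_subgraph D -> v \in sverts D ->
  (pi1_rank D v + #|` sverts D| = #|` sedges D|.+1)%N.
Proof.
move=> conn vD; have [T [t tr]] := spanning_tree conn vD.
have -> : pi1_rank D v = #|` sedges D `\` T|.
  apply: xget_unique.
    by split; [exact: pi1_generated_by_chords tr|exact: leq_chords_generators tr].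
  move=> k [kgen kmin]; apply/eqP; rewrite eqn_leq.
  by rewrite (leq_chords_generators tr kgen) kmin //; exact: pi1_generated_by_chords tr.
have Tsub := tree_sub tr.
by rewrite (tree_card tr) addnS cardfsDS // subnK // fsubset_leq_card.
Qed.

Lemma beta2_connected : connected_subgraph D ->
  (beta2 D + #|` sverts D| = #|` sedges D|.+1)%N.
Proof.
move=> conn; have [/fset0Pn[v vD] jn] := conn.
have comp w : w \in sverts D -> component D w = sverts D.
  move=> wD; apply/fsetP => u; rewrite !inE /=; case: (boolP (u \in _)) => //= uD.
  by apply/asboolP/jn.
rewrite /beta2; have -> : components D = [fset sverts D].
  apply/fsetP => C; rewrite inE; apply/imfsetP/eqP => [[w /= wD ->]|->].
    exact: comp.
  by exists v; rewrite ?comp.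
rewrite big_seq_fset1 pi1_rank_connected //.
by apply: (@xgetPex _ 1%g [set w | w \in sverts D]%classic); exists v.
Qed.

End Walks.

(** * Finite sets of vertices and the edges that they span *)

Section Inner.

Local Open Scope fset_scope.
Local Open Scope group_scope.

Variables (K : groupType) (P : presentation K).

Implicit Types (F A B U V : {fset K}) (e : cedge P).

(** The edges of the Cayley graph with both ends in [F]. *)
Definition inner F : {fset cedge P} :=
  [fset e in F `*` [fset x in pgen P] | ctarget e \in F].

Lemma in_inner F e : (e \in inner F) = (csource e \in F) && (ctarget e \in F).
Proof. by case: e => g x; rewrite !inE /= andbT. Qed.

Lemma inner_source F e : e \in inner F -> csource e \in F.
Proof. by rewrite in_inner => /andP[]. Qed.

Lemma inner_target F e : e \in inner F -> ctarget e \in F.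
Proof. by rewrite in_inner => /andP[]. Qed.

(** The subgraph spanned by [F]. *)
Definition induced F : subgraph P := Subgraph (@inner_source F) (@inner_target F).

Lemma subgraph_inner (D : subgraph P) : sedges D `<=` inner (sverts D).
Proof.
apply/fsubsetP => e eD.
by rewrite in_inner (sedges_source eD) (sedges_target eD).
Qed.

Lemma innerS A B : A `<=` B -> inner A `<=` inner B.
Proof.
move=> /fsubsetP AB; apply/fsubsetP => e; rewrite !in_inner => /andP[/AB -> /AB ->] //.
Qed.

Lemma card_product (T1 T2 : choiceType) (X : {fset T1}) (Y : {fset T2}) :
  #|` X `*` Y| = (#|` X| * #|` Y|)%N.
Proof.
rewrite /fsetM (perm_size (enum_imfset2 _ _)) ?size_allpairs //.
by move=> [a b] [c d] _ _ /= [-> ->].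
Qed.

Lemma card_inner_total F : (forall g, g \in F) -> #|` inner F| = (#|pgen P| * #|` F|)%N.
Proof.
move=> FT; rewrite mulnC -(card_finset (T := pgen P) predT) -card_product; congr #|` _|.
by apply/fsetP => -[g x]; rewrite in_inner !FT !inE /= FT.
Qed.

Lemma card_inner_le F : (#|` inner F| <= #|pgen P| * #|` F|)%N.
Proof.
rewrite mulnC -(card_finset (T := pgen P) predT) -card_product; apply: fsubset_leq_card.
by apply/fsubsetP => e; rewrite inE => /andP[].
Qed.

Lemma card_innerUI A B :
  (#|` inner A| + #|` inner B| <= #|` inner (A `|` B)| + #|` inner (A `&` B)|)%N.
Proof.
rewrite -cardfsUI; apply: leq_add; apply: fsubset_leq_card.
  by rewrite fsubUset !innerS ?fsubsetUl ?fsubsetUr.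
apply/fsubsetP => e; rewrite inE !in_inner => /andP[/andP[sA tA] /andP[sB tB]].
by rewrite !inE sA sB tA.
Qed.

(** Left translation is an automorphism of the Cayley graph. *)
Definition translate (g : K) F : {fset K} := [fset g * f | f in F].

Lemma mem_translate g F h : (h \in translate g F) = (g^-1 * h \in F).
Proof.
apply/imfsetP/idP => [[f /= fF ->]|hF]; first by rewrite mulKg.
by exists (g^-1 * h); rewrite ?mulVKg.
Qed.

Lemma card_translate g F : #|` translate g F| = #|` F|.
Proof. by rewrite card_imfset //; apply: mulgI. Qed.

Lemma card_inner_translate g F : #|` inner (translate g F)| = #|` inner F|.
Proof.
have -> : inner (translate g F) = [fset (g * e.1, e.2) | e in inner F].
  apply/fsetP => -[h x]; rewrite in_inner !mem_translate /csource /ctarget /= mulgA.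
  apply/idP/imfsetP => [hx|[[f y] /= /[!in_inner] fy [-> ->]]]; last by rewrite mulKg.
  by exists (g^-1 * h, x); rewrite /= ?in_inner // mulVKg.
rewrite card_imfset // => -[h x] [h' x'] /= [/mulgI -> ->] //.
Qed.

Lemma joined_sym (D : subgraph P) v w : joined D v w -> joined D w v.
Proof. by case=> p /walk_inv; exists (inv_word p). Qed.

Lemma joined_trans (D : subgraph P) u v w : joined D u v -> joined D v w -> joined D u w.
Proof. by case=> p up [q vq]; exists (p ++ q); apply: walk_cat vq. Qed.

Lemma joined_edge F e : e \in inner F -> joined (induced F) (csource e) (ctarget e).
Proof.
move=> eF; exists [:: (e, false)].
exact: (@walk_letter _ _ (induced F) (e, false)).
Qed.

Lemma joined_induced F v w : joined (induced F) v w -> w \in F.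
Proof. by case=> p /walk_target. Qed.

Lemma joinedS A B v w : A `<=` B -> joined (induced A) v w -> joined (induced B) v w.
Proof.
move=> AB [p vp]; exists p; elim: p v vp => [|a p IH] v /=.
  by case/andP=> /(fsubsetP AB) -> ->.
by case/and3P=> /(fsubsetP (innerS AB)) -> -> /IH.
Qed.

(** [F] is non-empty and spans a connected subgraph. *)
Local Notation conn F := (connected_subgraph (induced F)).

Lemma conn1 g : conn [fset g].
Proof.
split=> [|v w]; first by apply/fset0Pn; exists g; rewrite inE.
by rewrite !inE => /eqP -> /eqP ->; exists [::]; rewrite /= inE eqxx.
Qed.

Lemma conn_hub F v : v \in F -> (forall w, w \in F -> joined (induced F) v w) ->
  conn F.
Proof.
move=> vF vj; split=> [|u w uF wF]; first by apply/fset0Pn; exists v.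
exact: joined_trans (joined_sym (vj _ uF)) (vj _ wF).
Qed.

Lemma conn_translate g F : conn F -> conn (translate g F).
Proof.
case=> /fset0Pn[f fF] jF; apply: (@conn_hub _ (g * f)).
  by rewrite mem_translate mulKg.
move=> w; rewrite mem_translate => wF; have [p] := jF _ _ fF wF.
rewrite -[w in joined _ _ w](mulVKg g); move: (g^-1 * w) => h H.
exists [seq ((g * a.1.1, a.1.2), a.2) | a <- p].
elim: p f {fF} H => [|[[k x] b] p IH] f /=.
  by case/andP=> fF /eqP <-; rewrite mem_translate mulKg fF eqxx.
case/and3P=> kF /eqP <- /IH.
have kF' : (g * k, x) \in inner (translate g F).
  by move: kF; rewrite !in_inner !mem_translate /csource /ctarget /= -mulgA !mulKg.
by rewrite kF'; case: b; rewrite /origin /terminus /csource /ctarget /= ?mulgA eqxx.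
Qed.

(** The union of two connected sets is connected if an edge joins them. *)
Lemma conn_union A B e : conn A -> conn B -> csource e \in A `|` B ->
  ctarget e \in A `|` B -> (csource e \in A) && (ctarget e \in B) ||
  (csource e \in B) && (ctarget e \in A) -> conn (A `|` B).
Proof.
move=> [_ jA] [_ jB] sAB tAB H.
have eAB : e \in inner (A `|` B) by rewrite in_inner sAB.
have [a [b [aA bB ab]]] : exists a b,
    [/\ a \in A, b \in B & joined (induced (A `|` B)) a b].
  case/orP: H => /andP[h1 h2].
    by exists (csource e), (ctarget e); split=> //; apply: joined_edge.
  by exists (ctarget e), (csource e); split=> //; apply/joined_sym/joined_edge.
apply: (@conn_hub _ a); first by rewrite inE aA.
move=> w; rewrite inE => /orP[wA|wB]; first exact: joinedS (fsubsetUl _ _) (jA _ _ aA wA).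
exact: joined_trans ab (joinedS (fsubsetUr _ _) (jB _ _ bB wB)).
Qed.

(** A disconnected set splits into two parts without edges between them: one
   component and the rest. *)
Lemma not_conn_split F : F != fset0 -> ~ conn F ->
  exists A B, [/\ A != fset0, B != fset0, (#|` A| + #|` B| = #|` F|)%N &
    (#|` inner F| <= #|` inner A| + #|` inner B|)%N].
Proof.
move=> F0 nF; have /fset0Pn[v vF] := F0.
pose A := component (induced F) v.
have inA w : (w \in A) = `[< joined (induced F) v w >].
  by rewrite !inE /=; apply: andb_idl => /asboolP /joined_induced.
have AF : A `<=` F by apply/fsubsetP => w; rewrite inA => /asboolP /joined_induced.
exists A, (F `\` A); split.
- by apply/fset0Pn; exists v; rewrite inA; apply/asboolP; exists [::]; rewrite /= vF eqxx.
- apply/eqP => FA; apply: nF; apply: (conn_hub vF) => w wF.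
  apply/asboolP; rewrite -inA; apply: contraT => wA.
  have : w \in F `\` A by rewrite inE wA.
  by rewrite FA inE.
- by rewrite cardfsDS // subnKC // fsubset_leq_card.
- rewrite -cardfsUI; apply: leq_trans (leq_addr _ _); apply: fsubset_leq_card.
  apply/fsubsetP => e eF; have := eF; rewrite in_inner => /andP[sF tF].
  have st : (csource e \in A) = (ctarget e \in A).
    rewrite !inA; apply/asboolP/asboolP => h; apply: joined_trans h _.
      exact: joined_edge.
    exact/joined_sym/joined_edge.
  by rewrite in_fsetU !in_inner !in_fsetD sF tF st; case: (ctarget e \in A).
Qed.

(** The Cayley graph is connected: a finite non-empty set of vertices which is
   not the whole group has an edge leaving it. *)
Lemma outer_neighbour U g : U != fset0 -> g \notin U ->
  exists2 e : cedge P, (csource e \in U) || (ctarget e \in U) &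
    (csource e \notin U) || (ctarget e \notin U).
Proof.
case/fset0Pn=> u uU; have [w] := pval_generates P (u^-1 * g).
rewrite -{2}(mulVKg u g) => <-; elim: w u uU => [|[x b] w IH] u uU.
  by rewrite eval_word_nil mulg1 uU.
rewrite eval_word_cons mulgA.
have [xU /IH|xU _] := boolP (u * eval_letter (pval P) (x, b) \in U); first exact.
case: b xU => xU; last by exists (u, x); rewrite /csource /ctarget /= ?uU ?xU ?orbT.
exists (u * (pval P x)^-1, x); rewrite /csource /ctarget /= ?mulgVK ?uU ?orbT //.
by rewrite [X in X || _]xU.
Qed.

End Inner.

Local Notation conn P F := (connected_subgraph (induced P F)).

(** * The edge density of a presentation *)

Section Density.

Local Open Scope fset_scope.
Local Open Scope ring_scope.

Variables (R : realType) (K : groupType) (P : presentation K).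

Implicit Types (F A B U V : {fset K}).

(** The densities of the finite non-empty sets of vertices. *)
Definition densities : set R :=
  [set q | exists2 F : {fset K}, F != fset0 & q = #|` inner P F|%:R / #|` F|%:R]%classic.

(** The supremum, over the finite non-empty sets [F] of vertices of the Cayley
   graph, of the number of edges inside [F] per vertex of [F]. *)
Definition edge_density : R := sup densities.

Local Notation alpha := edge_density.

Let card_pos F : F != fset0 -> 0 < #|` F|%:R :> R.
Proof. by rewrite ltr0n cardfs_gt0. Qed.

Lemma densities_sup : has_sup densities.
Proof.
split.
  exists (#|` inner P [fset 1%g]|%:R / #|` [fset 1%g : K]|%:R), [fset 1%g] => //.
  by apply/fset0Pn; exists 1%g; rewrite inE.
exists #|pgen P|%:R => _ [F F0 ->]; rewrite ler_pdivrMr ?card_pos // -natrM ler_nat.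
exact: card_inner_le.
Qed.

Lemma card_inner_le_density F : #|` inner P F|%:R <= alpha * #|` F|%:R.
Proof.
have [->|F0] := eqVneq F fset0.
  rewrite cardfs0 mulr0 lern0; have := card_inner_le P fset0.
  by rewrite cardfs0 muln0 leqn0.
rewrite -ler_pdivrMr ?card_pos //; apply: sup_upper_bound densities_sup _ _.
by exists F.
Qed.

Lemma edge_density_le (c : R) :
  (forall F, #|` inner P F|%:R <= c * #|` F|%:R) -> alpha <= c.
Proof.
move=> Hc; apply: ge_sup; first by case: densities_sup.
by move=> _ [F F0 ->]; rewrite ler_pdivrMr ?card_pos.
Qed.

Lemma edge_density_le_gen : alpha <= #|pgen P|%:R.
Proof.
by apply: edge_density_le => F; rewrite -natrM ler_nat card_inner_le.
Qed.

Lemma edge_density_approx (eps : R) : 0 < eps ->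
  exists2 F, F != fset0 & (alpha - eps) * #|` F|%:R <= #|` inner P F|%:R.
Proof.
move=> e0; have [_ [F F0 ->]] := sup_adherent e0 densities_sup.
by move/ltW; rewrite ler_pdivlMr ?card_pos // => ?; exists F.
Qed.

(** If [F] has density at least [c], then so has one of the components of the
   subgraph that it spans. *)
Lemma conn_dense (c : R) F : F != fset0 -> c * #|` F|%:R <= #|` inner P F|%:R ->
  exists2 F', conn P F' & c * #|` F'|%:R <= #|` inner P F'|%:R.
Proof.
have [n] := ubnP #|` F|; elim: n F => // n IH F Fn F0 Fc.
have [cF|nF] := pselect (conn P F); first by exists F.
have [A [B [A0 B0 AB iAB]]] := not_conn_split F0 nF.
have [hA|hA] := leP (c * #|` A|%:R) #|` inner P A|%:R.
  apply: (IH A) => //; rewrite -ltnS; apply: leq_trans Fn.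
  by rewrite !ltnS -AB -addn1 leq_add2l cardfs_gt0.
apply: (IH B) => //.
  by rewrite -ltnS; apply: leq_trans Fn; rewrite !ltnS -AB -add1n leq_add2r cardfs_gt0.
move: Fc; rewrite -AB natrD; move: iAB; rewrite -(ler_nat R) natrD.
set x := _%:R in hA *; lra.
Qed.

(** How far a set of vertices is from the maximal density. *)
Definition defect F : R := alpha * #|` F|%:R - #|` inner P F|%:R.

Lemma defect_ge0 F : 0 <= defect F.
Proof. by rewrite subr_ge0 card_inner_le_density. Qed.

(** The defect is subadditive, being submodular and non-negative. *)
Lemma defect_union A B : defect (A `|` B) <= defect A + defect B.
Proof.
have := defect_ge0 (A `&` B); rewrite /defect.
have := congr1 (fun k => alpha * k%:R) (cardfsUI A B); rewrite /= !natrD !mulrDr.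
have := card_innerUI P A B; rewrite -(ler_nat R) !natrD; lra.
Qed.

Lemma defect_translate g F : defect (translate g F) = defect F.
Proof. by rewrite /defect card_translate card_inner_translate. Qed.

Lemma defect_total F : (forall g, g \in F) -> defect F <= 0.
Proof.
move=> FT; rewrite subr_le0 card_inner_total // natrM.
by rewrite ler_wpM2r // edge_density_le_gen.
Qed.

(** A finite connected set which is not the whole group can be enlarged by an
   overlapping or adjacent translate of any other connected set. *)
Lemma conn_grow U F : conn P U -> conn P F -> ~ (forall g, g \in U) ->
  exists V, [/\ U `<=` V, conn P V, (#|` U| < #|` V|)%N, (#|` F| <= #|` V|)%N &
    defect V <= defect U + defect F].
Proof.
move=> cU cF /existsNP[g /negP gU].
have U0 : U != fset0 by case: cU.
have [e eU eN] := outer_neighbour P U0 gU.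
have [f fF] : exists f, f \in F by apply/fset0Pn; case: cF.
(* [p] is the end of [e] outside [U]. *)
pose p := if csource e \in U then ctarget e else csource e.
have pU : p \notin U.
  by rewrite /p; case: ifP eU eN => /= [_ _ ->|->].
pose B := translate (p * f^-1)%g F.
have pB : p \in B by rewrite mem_translate invgM invgK mulgVK.
have cB : conn P B by exact: conn_translate.
exists (U `|` B); split.
- exact: fsubsetUl.
- apply: (@conn_union _ _ _ _ e) => //; rewrite ?in_fsetU.
  + by move: pB; rewrite /p; case: ifP => //= _ ->; rewrite orbT.
  + by move: pB eU; rewrite /p; case: ifP => /= [_ ->|_ _ ->]; rewrite ?orbT.
  + by move: pB eU; rewrite /p; case: ifP => /= [_ ->|_ -> ->]; rewrite ?orbT.
- apply: fproper_ltn_card; apply: fproperUl; apply/fsubsetPn; by exists p.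
- by rewrite -(card_translate (p * f^-1) F) fsubset_leq_card // fsubsetUr.
- by rewrite -(defect_translate (p * f^-1) F) defect_union.
Qed.

(** At most [m] such steps: the set becomes the whole group, or every step adds
   at least one vertex and at most the defect of [F]. *)
Lemma conn_grow_iter U F m : conn P U -> conn P F ->
  exists V, [/\ U `<=` V, conn P V & (forall g, g \in V) \/
    [/\ (m <= #|` V|)%N, (0 < m -> #|` F| <= #|` V|)%N &
      defect V <= defect U + m%:R * defect F]].
Proof.
move=> cU cF; elim: m => [|m [V [UV cV H]]].
  by exists U; split=> //; right; split; rewrite // mul0r addr0.
have [VT|VN] := pselect (forall g, g \in V); first by exists V; split=> //; left.
case: H => // -[mV _ dV].
have [W [VW cW VWc FW dW]] := conn_grow cV cF VN.
exists W; split=> //; first exact: fsubset_trans VW.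
right; split=> //; first exact: leq_ltn_trans VWc.
by rewrite -natr1 mulrDl mul1r addrA; apply: le_trans dW _; rewrite lerD2r.
Qed.

(** Every finite connected set is contained in connected sets of nearly maximal
   density: with [M] large compared with the defect of [U], adjoin [M] translates
   of a connected set [F] whose defect is at most [(eps / 2M) |F|]. *)
Lemma conn_dense_above U (eps : R) : conn P U -> 0 < eps ->
  exists V, [/\ U `<=` V, conn P V & (alpha - eps) * #|` V|%:R <= #|` inner P V|%:R].
Proof.
move=> cU e0; pose M := (Num.truncn (defect U / (eps / 2))).+1.
have e20 : 0 < eps / 2 by rewrite divr_gt0.
have M0 : 0 < M%:R :> R by rewrite ltr0n.
have dU : defect U <= eps / 2 * M%:R.
  by rewrite mulrC -ler_pdivrMr // ltW // truncnS_gt.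
have [F0 F00 dF0] := edge_density_approx (divr_gt0 e20 M0).
have [F cF dF] := conn_dense F00 dF0.
have [V [UV cV HV]] := conn_grow_iter M cU cF.
exists V; split=> //; rewrite mulrBl lerBlDl -lerBlDr -/(defect V).
case: HV => [VT|[MV FV dV]].
  by apply: le_trans (defect_total VT) _; rewrite mulr_ge0 // ltW.
apply: le_trans dV _.
have -> : eps * #|` V|%:R = eps / 2 * #|` V|%:R + eps / 2 * #|` V|%:R.
  by rewrite -mulrDl -splitr.
apply: lerD; first by apply: le_trans dU _; rewrite ler_pM2l // ler_nat.
have {}dF : defect F <= eps / 2 / M%:R * #|` F|%:R.
  by move: dF; rewrite /defect mulrBl; lra.
apply: (@le_trans _ _ (eps / 2 * #|` F|%:R)); last by rewrite ler_pM2l // ler_nat FV.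
rewrite mulrC -ler_pdivlMr //; apply: le_trans dF _.
by rewrite mulrAC.
Qed.

End Density.

(** * Additivity of the edge density *)

Section ProductDensity.

Local Open Scope fset_scope.

Lemma in_fset_filter (T : choiceType) (S : {fset T}) (p : pred T) x :
  (x \in [fset s in S | p s]) = (x \in S) && p x.
Proof. by rewrite !inE. Qed.

Lemma card_fset_filter (T : choiceType) (S : {fset T}) (p : pred T) :
  #|` [fset s in S | p s]| = \sum_(s <- S) p s.
Proof. by rewrite card_fset_sum1 big_fset /= big_mkcond. Qed.

Lemma card_fibers (T U : choiceType) (h : T -> U) (S : {fset T}) (B : {fset U}) :
  (forall s, s \in S -> h s \in B) ->
  #|` S| = \sum_(b <- B) #|` [fset s in S | h s == b]|.
Proof.
move=> hB; under eq_bigr do rewrite card_fset_filter.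
rewrite exchange_big /= card_fset_sum1 !big_seq; apply: eq_bigr => s sS.
have hs := hB _ sS; rewrite (big_fsetD1 _ hs) /= eqxx big_seq big1 // => b.
by rewrite !inE eq_sym => /andP[/negPf ->].
Qed.

Variables (G1 G2 : groupType) (P1 : presentation G1) (P2 : presentation G2).

Local Notation P := (prod_presentation P1 P2).

Implicit Types F : {fset G1 * G2}.

(** The two families of slices of a finite subset of the product. *)
Definition slice1 F (b : G2) : {fset G1} := [fset p.1 | p in [fset p in F | p.2 == b]].
Definition slice2 F (a : G1) : {fset G2} := [fset p.2 | p in [fset p in F | p.1 == a]].

Lemma in_slice1 F a b : (a \in slice1 F b) = ((a, b) \in F).
Proof.
apply/imfsetP/idP => [[[a' b'] /=]|abF]; last first.
  by exists (a, b); rewrite // !inE /= abF eqxx.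
by rewrite !inE /= => /andP[H /eqP <-] ->.
Qed.

Lemma in_slice2 F a b : (b \in slice2 F a) = ((a, b) \in F).
Proof.
apply/imfsetP/idP => [[[a' b'] /=]|abF]; last first.
  by exists (a, b); rewrite // !inE /= abF eqxx.
by rewrite !inE /= => /andP[H /eqP <-] ->.
Qed.

Lemma card_slices1 F : #|` F| = \sum_(b <- [fset p.2 | p in F]) #|` slice1 F b|.
Proof.
rewrite (@card_fibers _ _ snd _ [fset p.2 | p in F]); last first.
  by move=> p pF; rewrite in_imfset.
apply: eq_bigr => b _; rewrite [RHS]card_in_imfset //= => -[a c] [a' c'].
by rewrite !inE /= => /andP[_ /eqP ->] /andP[_ /eqP ->] ->.
Qed.

Lemma card_slices2 F : #|` F| = \sum_(a <- [fset p.1 | p in F]) #|` slice2 F a|.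
Proof.
rewrite (@card_fibers _ _ fst _ [fset p.1 | p in F]); last first.
  by move=> p pF; rewrite in_imfset.
apply: eq_bigr => b _; rewrite [RHS]card_in_imfset //= => -[a c] [a' c'].
by rewrite !inE /= => /andP[_ /eqP ->] /andP[_ /eqP ->] ->.
Qed.

(* The edge is labelled by a generator of the first factor. *)
Let is_inl (e : cedge P) := if e.2 is inl _ then true else false.

Let in_inner_inl F a b x :
  ((a, b, inl x) \in inner P F) = ((a, x) \in inner P1 (slice1 F b)).
Proof.
by rewrite (@in_inner _ P) in_inner !in_slice1 /csource /ctarget /= pair_mulg mulg1.
Qed.

Let in_inner_inr F a b y :
  ((a, b, inr y) \in inner P F) = ((b, y) \in inner P2 (slice2 F a)).
Proof.
by rewrite (@in_inner _ P) in_inner !in_slice2 /csource /ctarget /= pair_mulg mulg1.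
Qed.

(** An edge of the product varies at most one of the two coordinates, hence lies
   in one slice. *)
Lemma card_inner_slices F : #|` inner P F| =
  (\sum_(b <- [fset p.2 | p in F]) #|` inner P1 (slice1 F b)| +
   \sum_(a <- [fset p.1 | p in F]) #|` inner P2 (slice2 F a)|)%N.
Proof.
have -> : #|` inner P F| = (#|` [fset e in inner P F | is_inl e]| +
    #|` [fset e in inner P F | ~~ is_inl e]|)%N.
  rewrite 2!(card_fset_filter (inner P F)) -big_split card_fset_sum1 /=.
  by apply: eq_bigr => e _; case: is_inl.
congr (_ + _)%N.
  rewrite (@card_fibers _ _ (fun e => e.1.2) _ [fset p.2 | p in F]); last first.
    move=> e; rewrite in_fset_filter in_inner => /andP[/andP[eF _] _].
    by rewrite in_imfset.
  apply: eq_bigr => b _.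
  have -> : [fset e in [fset e in inner P F | is_inl e] | e.1.2 == b] =
      [fset (((e.1, b), inl e.2) : cedge P) | e in inner P1 (slice1 F b)].
    apply/fsetP => -[[a c] [x|y]]; rewrite 2!in_fset_filter /is_inl /=.
      rewrite in_inner_inl andbT; apply/andP/imfsetP => [[h /eqP e]|].
        by exists (a, x); rewrite /= -e.
      by case=> -[a' x'] /= h [-> -> ->]; rewrite h eqxx.
    by rewrite andbF /=; apply/esym/imfsetP; case=> -[].
  by rewrite card_imfset //= => -[a x] [a' x'] /= [-> ->].
rewrite (@card_fibers _ _ (fun e => e.1.1) _ [fset p.1 | p in F]); last first.
  by move=> e; rewrite in_fset_filter in_inner => /andP[/andP[eF _] _]; rewrite in_imfset.
apply: eq_bigr => a _.
have -> : [fset e in [fset e in inner P F | ~~ is_inl e] | e.1.1 == a] =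
    [fset (((a, e.1), inr e.2) : cedge P) | e in inner P2 (slice2 F a)].
  apply/fsetP => -[[c b] [x|y]]; rewrite 2!in_fset_filter /is_inl /=.
    by rewrite andbF /=; apply/esym/imfsetP; case=> -[].
  rewrite in_inner_inr andbT; apply/andP/imfsetP => [[h /eqP e]|].
    by exists (b, y); rewrite /= -e.
  by case=> -[b' y'] /= h [-> -> ->]; rewrite h eqxx.
by rewrite card_imfset //= => -[b x] [b' x'] /= [-> ->].
Qed.

Local Open Scope ring_scope.

Variable R : realType.

Local Notation alpha1 := (edge_density R P1).
Local Notation alpha2 := (edge_density R P2).

(** The edge density is additive: a finite subset of the product is no denser
   than its slices, and the product of two sets attains the sum of their
   densities. *)
Lemma edge_density_prod : edge_density R P = alpha1 + alpha2.
Proof.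
apply/le_anti/andP; split.
  apply: edge_density_le => F; rewrite card_inner_slices natrD mulrDl; apply: lerD.
    rewrite card_slices1 !natr_sum mulr_sumr; apply: ler_sum => b _.
    exact: card_inner_le_density.
  rewrite card_slices2 !natr_sum mulr_sumr; apply: ler_sum => a _.
  exact: card_inner_le_density.
apply/ler_addgt0Pr => eps e0; have e2 : 0 < eps / 2 by rewrite divr_gt0.
have [F1 F10 d1] := edge_density_approx P1 e2.
have [F2 F20 d2] := edge_density_approx P2 e2.
pose F := F1 `*` F2.
have [f1 f1F] := fset0Pn _ F10; have [f2 f2F] := fset0Pn _ F20.
have pr1 : [fset p.1 | p in F] = F1.
  apply/fsetP => a; apply/imfsetP/idP => [[p /=]|aF].
    by rewrite inE => /andP[pF _] ->.
  by exists (a, f2); rewrite //= inE aF.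
have pr2 : [fset p.2 | p in F] = F2.
  apply/fsetP => a; apply/imfsetP/idP => [[p /=]|aF].
    by rewrite inE => /andP[_ pF] ->.
  by exists (f1, a); rewrite //= inE aF f1F.
have := card_inner_le_density R P F.
rewrite card_inner_slices pr1 pr2 natrD !natr_sum card_product natrM.
set n1 : R := #|` F1|%:R; set n2 : R := #|` F2|%:R.
have -> : \sum_(b <- F2) #|` inner P1 (slice1 F b)|%:R = #|` inner P1 F1|%:R * n2 :> R.
  rewrite /n2 (card_fset_sum1 F2) natr_sum mulr_sumr; apply: eq_big_seq => b bF.
  suff -> : slice1 F b = F1 by rewrite mulr1.
  by apply/fsetP => a; rewrite in_slice1 inE /= bF andbT.
have -> : \sum_(a <- F1) #|` inner P2 (slice2 F a)|%:R = #|` inner P2 F2|%:R * n1 :> R.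
  rewrite /n1 (card_fset_sum1 F1) natr_sum mulr_sumr; apply: eq_big_seq => a aF.
  suff -> : slice2 F a = F2 by rewrite mulr1.
  by apply/fsetP => b; rewrite in_slice2 inE /= aF.
have n10 : 0 < n1 by rewrite ltr0n cardfs_gt0.
have n20 : 0 < n2 by rewrite ltr0n cardfs_gt0.
have {}d1 : (alpha1 - eps / 2) * n1 * n2 <= #|` inner P1 F1|%:R * n2 by rewrite ler_pM2r.
have {}d2 : (alpha2 - eps / 2) * n2 * n1 <= #|` inner P2 F2|%:R * n1 by rewrite ler_pM2r.
move=> d; rewrite -(ler_pM2r (mulr_gt0 n10 n20)).
move: d1 d2 d; set u : R := #|` inner P1 F1|%:R; set v : R := #|` inner P2 F2|%:R; lra.
Qed.

End ProductDensity.

(** * The cyclomatic quotient in terms of the edge density *)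

Section LimSup.

Local Open Scope ereal_scope.

Lemma le_limn_esup (R : realType) (u v : nat -> \bar R) :
  (forall n, u n <= v n) -> limn_esup u <= limn_esup v.
Proof.
move=> uv; apply: le_ereal_inf_tmp => _ [V VF <-].
apply: ge_ereal_inf; exists (ereal_sup (u @` V)%classic); first by exists V.
apply: ge_ereal_sup => _ [n Vn <-]; apply: le_ereal_sup_tmp.
by exists (v n) => //; exists n.
Qed.

End LimSup.

Section CyclomaticDensity.

Local Open Scope fset_scope.
Local Open Scope ring_scope.

Variables (R : realType) (K : groupType) (P : presentation K).

Implicit Types (F U V : {fset K}) (D : nat -> subgraph P).

Local Notation alpha := (edge_density R P).

Lemma xi_connected (D : subgraph P) : connected_subgraph D ->
  xi R D = #|` sedges D|%:R / (beta0 D)%:R - 1 + (beta0 D)%:R^-1.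
Proof.
move=> cD; have V0 : (beta0 D)%:R != 0 :> R by rewrite pnatr_eq0 cardfs_eq0; case: cD.
have := congr1 (fun k => k%:R : R) (beta2_connected cD).
rewrite natrD -natr1 -/(beta0 D) => e.
rewrite -[X in _ - X](divff V0) -[X in _ + X]mul1r -mulrBl -mulrDl.
by rewrite /xi -addrAC -e addrK.
Qed.

(** A finite set of vertices is covered from some stage of the chain on. *)
Lemma chain_covers D F : exhausting_chain D ->
  exists N, forall i, (N <= i)%N -> F `<=` sverts (D i).
Proof.
case=> _ Dmono Dcov _.
have mono i j : (i <= j)%N -> sverts (D i) `<=` sverts (D j).
  move=> /subnK <-; elim: (j - i)%N => // k /fsubset_trans; apply.
  by have [] := Dmono (k + i)%N.
elim/finSet_rect: F => F IH; have [->|/fset0Pn[g gF]] := eqVneq F fset0.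
  by exists 0%N.
have [N HN] := IH _ (fproperD1 gF); have [M HM] := Dcov g.
exists (maxn N M) => i; rewrite geq_max => /andP[Ni Mi].
rewrite -(fsetD1K gF) fsubUset fsub1set HN // andbT.
exact: (fsubsetP (mono _ _ Mi)).
Qed.

(** An exhausting chain is eventually constant on vertices if [K] is finite, and
   its numbers of vertices are unbounded otherwise. *)
Lemma inv_beta0_cvg D : exhausting_chain D ->
  ((beta0 (D i))%:R^-1 @[i --> \oo] --> (inv_card R K : R))%classic.
Proof.
move=> ch; rewrite /inv_card; case: asboolP => [fin|inf].
  have [N HN] := chain_covers (fset_set [set: K]) ch.
  apply: cvg_near_cst; exists N => // i Ni; rewrite /beta0 /=.
  suff -> : sverts (D i) = fset_set [set: K] by [].
  apply/eqP; rewrite eqEfsubset HN // andbT; apply/fsubsetP => g _.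
  by rewrite in_fset_set // inE.
apply/gtr0_cvgV0.
  near=> i; rewrite ltr0n cardfs_gt0; have [cD _ _ _] := ch; by case: (cD i).
apply/cvgrnyP/cvgnyPge => A.
have [F _ FA] := infinite_set_fset A inf.
have [N HN] := chain_covers F ch.
exists N => // i Ni /=; apply: leq_trans FA _; exact: fsubset_leq_card (HN _ Ni).
Unshelve. all: end_near.
Qed.

Local Notation limit := (alpha - 1 + inv_card R K).

Lemma cvg_shift_inv_beta0 D (c : R) : exhausting_chain D ->
  ((c + (beta0 (D i))%:R^-1)%:E @[i --> \oo] --> (c + inv_card R K)%:E)%classic.
Proof.
move=> ch; apply: cvg_EFin; first exact: nearW.
by apply: cvgD; [exact: cvg_cst|exact: inv_beta0_cvg].
Qed.

Lemma limn_esup_xi_le D : exhausting_chain D ->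
  (limn_esup (fun i => (xi R (D i))%:E) <= limit%:E)%E.
Proof.
move=> ch; have [_ <-] := cvg_limn_einf_sup (cvg_shift_inv_beta0 (c := alpha - 1) ch).
apply: le_limn_esup => i; rewrite lee_fin; have [/(_ i) cD _ _ _] := ch.
rewrite xi_connected // lerD2r lerD2r ler_pdivrMr; last first.
  by rewrite ltr0n cardfs_gt0; case: cD.
apply: le_trans (card_inner_le_density R P _); rewrite ler_nat.
exact: fsubset_leq_card (subgraph_inner _).
Qed.

(** [U] together with all the neighbours of its elements. *)
Definition ball U : {fset K} :=
  U `|` [fset (p.1 * pval P p.2)%g | p in U `*` [fset x in pgen P]]
    `|` [fset (p.1 * (pval P p.2)^-1)%g | p in U `*` [fset x in pgen P]].

Lemma sub_ball U : U `<=` ball U.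
Proof. by rewrite /ball -fsetUA fsubsetUl. Qed.

Lemma mem_ball U u l : u \in U -> (u * eval_letter (pval P) l)%g \in ball U.
Proof.
case: l => x b uU; rewrite /ball !in_fsetU /eval_letter /=; case: b.
  by apply/orP; right; apply/imfsetP; exists (u, x); rewrite //= !inE /= uU.
apply/orP; left; apply/orP; right; apply/imfsetP.
by exists (u, x); rewrite //= !inE /= uU.
Qed.

Lemma conn_ball U : conn P U -> conn P (ball U).
Proof.
move=> [/fset0Pn[v vU] jU].
have vj u : u \in U -> joined (induced P (ball U)) v u.
  by move=> uU; apply: joinedS (sub_ball _) (jU _ _ vU uU).
apply: (@conn_hub _ _ _ v); first exact: (fsubsetP (sub_ball U)).
move=> w; rewrite {1}/ball !in_fsetU -orbA => /or3P[|/imfsetP|/imfsetP]; first exact: vj.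
- case=> -[u x] /= /[!inE] /andP[uU _] ->; apply: joined_trans (vj _ uU) _.
  apply: (@joined_edge _ _ _ (u, x)); rewrite in_inner (fsubsetP (sub_ball U) _ uU) /=.
  exact: (mem_ball (x, false)).
- case=> -[u x] /= /[!inE] /andP[uU _] ->; apply: joined_trans (vj _ uU) _.
  have := @joined_edge _ _ (ball U) ((u * (pval P x)^-1)%g, x).
  rewrite in_inner /csource /ctarget /= mulgVK (fsubsetP (sub_ball U) _ uU) andbT.
  by move=> h; apply/joined_sym/h; exact: (mem_ball (x, true)).
Qed.

(** Alternating the passage to a neighbourhood, which exhausts the group, with
   the passage to a denser set. *)
Lemma dense_chain (eps : R) : 0 < eps ->
  exists2 D : nat -> subgraph P, exhausting_chain D &
    forall i, (alpha - eps) * (beta0 (D i))%:R <= #|` sedges (D i)|%:R.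
Proof.
move=> e0.
have /choice[next nextP] U : exists V, conn P U ->
    [/\ ball U `<=` V, conn P V & (alpha - eps) * #|` V|%:R <= #|` inner P V|%:R].
  have [cU|nU] := pselect (conn P U); last by exists U.
  by have [V HV] := conn_dense_above (conn_ball cU) e0; exists V.
pose U i := iter i.+1 next [fset 1%g].
have cU i : conn P (U i).
  elim: i => [|i IH]; last by have [] := nextP _ IH.
  by have [] := nextP _ (conn1 P 1%g).
have UP i : [/\ ball (U i) `<=` U i.+1, conn P (U i.+1) &
  (alpha - eps) * #|` U i.+1|%:R <= #|` inner P (U i.+1)|%:R] := nextP _ (cU i).
have US i : U i `<=` U i.+1.
  by have [h _ _] := UP i; apply: fsubset_trans (sub_ball _) h.
have Ucov g : exists i, g \in U i.
  have [w <-] := pval_generates P g; elim/last_ind: w => [|w l [i IH]].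
    exists 0%N; rewrite eval_word_nil; have [h _ _] := nextP _ (conn1 P 1%g).
    by apply: (fsubsetP (fsubset_trans (sub_ball _) h)); rewrite inE.
  exists i.+1; rewrite -cats1 eval_word_cat eval_word_cons eval_word_nil mulg1.
  by have [h _ _] := UP i; apply: (fsubsetP h); apply: mem_ball.
exists (fun i => induced P (U i)).
  split=> //.
  - by move=> i; split; [exact: US|exact: innerS].
  - case=> g x; have [i gi] := Ucov g; exists i.+1; rewrite /= in_inner.
    rewrite (fsubsetP (US i) _ gi) /=; have [h _ _] := UP i.
    by apply: (fsubsetP h); apply: (mem_ball (x, false)).
case=> [|i]; first by have [] := nextP _ (conn1 P 1%g).
by have [] := UP i.
Qed.

(** The cyclomatic quotient, in terms of the edge density: by Euler's formula,
   a connected subgraph has [E - V + 1] independent cycles. *)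
Lemma cyclomatic_quotientE : cyclomatic_quotient R P = limit%:E.
Proof.
apply/le_anti/andP; split.
  by apply: ge_ereal_sup => _ [D ch <-]; exact: limn_esup_xi_le.
apply/lee_addgt0Pr => eps e0; have [D ch dense] := dense_chain e0.
apply: (@le_trans _ _ ((limit - eps)%:E + eps%:E)%E); first by rewrite -EFinD subrK.
rewrite leeD2r //; apply: le_ereal_sup_tmp.
exists (limn_esup (fun i => (xi R (D i))%:E)); first by exists D.
rewrite addrAC.
have [_ <-] := cvg_limn_einf_sup (cvg_shift_inv_beta0 (c := alpha - 1 - eps) ch).
apply: le_limn_esup => i; rewrite lee_fin; have [/(_ i) cD _ _ _] := ch.
rewrite xi_connected // lerD2r addrAC lerD2r ler_pdivlMr; last first.
  by rewrite ltr0n cardfs_gt0; case: cD.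
exact: dense.
Qed.

End CyclomaticDensity.

(** * The cyclomatic quotient of a direct product *)

Theorem theorem4p1 (R : realType) (G1 G2 : groupType)
    (A1 : presentation G1) (A2 : presentation G2)
    (G1_nontrivial : exists g : G1, g <> 1%g)
    (G2_nontrivial : exists g : G2, g <> 1%g) :
  normalized_cyclomatic_quotient R (prod_presentation A1 A2) =
  (normalized_cyclomatic_quotient R A1 + normalized_cyclomatic_quotient R A2
   - (inv_card R G1 + inv_card R G2 - inv_card R (G1 * G2)%type)%R%:E)%E.
Proof.
rewrite /normalized_cyclomatic_quotient !cyclomatic_quotientE -EFinN -!EFinD.
congr (_%:E); rewrite edge_density_prod card_sum natrD; lra.
Qed.
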